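(* Consider $(x,s,\lambda)\in\mathbb{R}^n\times\mathbb{R}^m\times\mathbb{R}^m$ with $s>0$. Let $v\in\mathbb{R}^m$ and $\mu>0$ satisfy $s=\sqrt\mu e^{-v}$. Let $(\Delta x,\Delta s,\Delta\lambda)\in\mathbb{R}^n\times\mathbb{R}^m\times\mathbb{R}^m$ solve the primal barrier Newton system (with this $\mu$) $$A^T(\lambda+\Delta\lambda) = W(x+\Delta x)+c,\qquad s+\Delta s = A(x+\Delta x)+b,\qquad \mu(s^{-1}-s^{-2}\circ\Delta s) = \lambda+\Delta\lambda.$$ Then $s+\Delta s = s\circ(\mathbf{1}-d(v,\mu))$, where $d(v,\mu)$ is the log-domain Newton direction.
   Context: Data and standing assumptions: $A\in\mathbb{R}^{m\times n}$, $b\in\mathbb{R}^m$, $c\in\mathbb{R}^n$, and $W\in\mathbb{R}^{n\times n}$ is symmetric positive semidefinite. It is assumed that (i) there exists $x\in\mathbb{R}^n$ with $Ax+b>0$ (componentwise); (ii) for every $\gamma\in\mathbb{R}$ the set $\{x\in\mathbb{R}^n: \frac12 x^TWx + c^Tx\le\gamma,\ Ax+b\ge0\}$ is bounded; (iii) $A^TA+W$ is positive definite. Notation: $\circ$ is the elementwise product; $e^v$, $s^{-1}$, $s^{-2}$ are taken elementwise; $\mathbf{1}\in\mathbb{R}^m$ is the all-ones vector. Log-domain Newton direction: for $v\in\mathbb{R}^m$ and $\mu>0$, $d(v,\mu)\in\mathbb{R}^m$ is the (unique) $d$ that, together with a (unique) $x'\in\mathbb{R}^n$, satisfies $\sqrt\mu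 A^T(e^v+e^v\circ d) = Wx'+c$ and $\sqrt\mu(e^{-v}-e^{-v}\circ d) = Ax'+b$. The primal barrier Newton system is the linearization at $(x,s,\lambda)$ of the optimality conditions $A^T\lambda = Wx+c$, $s=Ax+b$, $\mu s^{-1}=\lambda$ of the problem: minimize $\frac12x^TWx+c^Tx-\mu\sum_{i=1}^m\log s_i$ over $(x,s)$ subject to $s=Ax+b$. *)

(* Defs.v *)
From HB Require Import structures.
From mathcomp Require Import all_boot all_order all_algebra.
From mathcomp Require Import all_classical all_reals all_analysis.

Set Implicit Arguments.
Unset Strict Implicit.
Unset Printing Implicit Defensive.

Import Order.TTheory GRing.Theory Num.Theory.
Import numFieldNormedType.Exports.

Local Open Scope classical_set_scope.
Local Open Scope ring_scope.

Notation "u '\odot' v" := (map2_mx *%R u v)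
  (at level 40, left associativity) : ring_scope.

Definition expmx {R : realType} {m n : nat} (u : 'M[R]_(m, n)) : 'M[R]_(m, n) :=
  map_mx expR u.

Definition quadform {R : realType} {n : nat} (M : 'M[R]_n) (x : 'cV[R]_n) : R :=
  (x^T *m M *m x) 0 0.

Definition possemidefmx {R : realType} {n : nat} (M : 'M[R]_n) : Prop :=
  M \is symmetricmx /\ forall x : 'cV[R]_n, 0 <= quadform M x.

Definition posdefmx {R : realType} {n : nat} (M : 'M[R]_n) : Prop :=
  M \is symmetricmx /\ forall x : 'cV[R]_n, x != 0 -> 0 < quadform M x.

Definition qp_objective {R : realType} {n : nat} (W : 'M[R]_n) (c x : 'cV[R]_n) : R :=
  2^-1 * quadform W x + (c^T *m x) 0 0.

Definition qp_sublevel {R : realType} {m n : nat} (A : 'M[R]_(m, n)) (b : 'cV[R]_m)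
    (c : 'cV[R]_n) (W : 'M[R]_n) (gamma : R) : set 'cV[R]_n :=
  [set x | qp_objective W c x <= gamma /\ forall i, 0 <= (A *m x + b) i 0].

(* Linearization in [v], along [d], of the optimality conditions
   [A^T lam = W x' + c], [s = A x' + b] under the substitution
   [lam = sqrt mu * exp v], [s = sqrt mu * exp (- v)]. *)
Definition log_newton_system {R : realType} {m n : nat} (A : 'M[R]_(m, n))
    (b : 'cV[R]_m) (c : 'cV[R]_n) (W : 'M[R]_n) (v : 'cV[R]_m) (mu : R)
    (d : 'cV[R]_m) (x' : 'cV[R]_n) : Prop :=
  Num.sqrt mu *: (A^T *m (expmx v + expmx v \odot d)) = W *m x' + c /\
  Num.sqrt mu *: (expmx (- v) - expmx (- v) \odot d) = A *m x' + b.

(* The system determines [d] uniquely under the standing assumptions; [xget]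
   returns the default [0] only if there is no solution. *)
Definition log_newton_dir {R : realType} {m n : nat} (A : 'M[R]_(m, n))
    (b : 'cV[R]_m) (c : 'cV[R]_n) (W : 'M[R]_n) (v : 'cV[R]_m) (mu : R) : 'cV[R]_m :=
  xget 0 [set d | exists x', log_newton_system A b c W v mu d x'].

(* Linearization at [(x, s, lam)] of [A^T lam = W x + c], [s = A x + b],
   [mu s^-1 = lam]. *)
Definition barrier_newton_system {R : realType} {m n : nat} (A : 'M[R]_(m, n))
    (b : 'cV[R]_m) (c : 'cV[R]_n) (W : 'M[R]_n) (mu : R)
    (x : 'cV[R]_n) (s lam : 'cV[R]_m)
    (dx : 'cV[R]_n) (ds dlam : 'cV[R]_m) : Prop :=
  [/\ A^T *m (lam + dlam) = W *m (x + dx) + c,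
      s + ds = A *m (x + dx) + b
    & mu *: (map_mx (fun t => t^-1) s - map_mx (fun t => t ^- 2) s \odot ds)
      = lam + dlam].

(* Main.v *)
(** The vector [d = - s^-1 \odot ds], together with [x + dx], solves the
    log-domain Newton system, so everything reduces to uniqueness of [d].  If
    [(d, y)] is the difference of two solutions, then
    [sqrt mu *: A^T (e^v \odot d) = W y] and
    [- sqrt mu *: (e^-v \odot d) = A y], hence
    [y^T W y = - mu * \sum_i d_i ^ 2], and [d = 0] because [W] is positive
    semidefinite. *)

Require Import Defs.
From HB Require Import structures.
From mathcomp Require Import all_boot all_order all_algebra.
From mathcomp Require Import all_classical all_reals all_analysis.
From mathcomp Require Import ring.

Set Implicit Arguments.
Unset Strict Implicit.
Unset Printing Implicit Defensive.

Import Order.TTheory GRing.Theory Num.Theory.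
Import numFieldNormedType.Exports.

Local Open Scope classical_set_scope.
Local Open Scope ring_scope.

Lemma log_newton_system_unique (R : realType) (m n : nat)
    (A : 'M[R]_(m, n)) (b : 'cV[R]_m) (c : 'cV[R]_n) (W : 'M[R]_n)
    (v : 'cV[R]_m) (mu : R) (d1 d2 : 'cV[R]_m) (x1 x2 : 'cV[R]_n) :
  (forall y : 'cV[R]_n, 0 <= quadform W y) -> 0 < mu ->
  log_newton_system A b c W v mu d1 x1 ->
  log_newton_system A b c W v mu d2 x2 -> d1 = d2.
Proof.
move=> W_ge0 mu_gt0 [dual1 primal1] [dual2 primal2].
have Wy : W *m (x1 - x2) =
    Num.sqrt mu *: (A^T *m (expmx v \odot (d1 - d2))).
  have -> : expmx v \odot (d1 - d2) =
      (expmx v + expmx v \odot d1) - (expmx v + expmx v \odot d2).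
    by apply/matrixP => i j; rewrite !mxE; ring.
  by rewrite !mulmxBr scalerBr dual1 dual2 opprD addrACA subrr addr0.
have Ay i : (A *m (x1 - x2)) i 0 =
    - (Num.sqrt mu * expR (- v i 0) * (d1 i 0 - d2 i 0)).
  have -> : A *m (x1 - x2) = (A *m x1 + b) - (A *m x2 + b).
    by rewrite mulmxBr opprD addrACA subrr addr0.
  by rewrite -primal1 -primal2 !mxE; ring.
have quadE : quadform W (x1 - x2) = - (mu * \sum_i (d1 i 0 - d2 i 0) ^+ 2).
  (* With [y = x1 - x2], [trmx_mul] turns [y^T A^T] into [(A y)^T], so that [Ay] applies entrywise;
     the factors [expR (v i 0)] and [expR (- v i 0)] then cancel. *)
  rewrite /quadform -mulmxA Wy -scalemxAr mulmxA -trmx_mul mxE.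
  rewrite mxE !mulr_sumr -sumrN; apply: eq_bigr => i _.
  (* Only the [mu] outside the square roots becomes [Num.sqrt mu ^+ 2]. *)
  rewrite mxE Ay !mxE -{3}(sqr_sqrtr (ltW mu_gt0)) expRN.
  by field; rewrite gt_eqF ?expR_gt0.
have sum0 : \sum_i (d1 i 0 - d2 i 0) ^+ 2 = 0.
  apply/eqP; rewrite eq_le sumr_ge0 ?andbT => [|i _]; last exact: sqr_ge0.
  (* Semidefiniteness of [W] enters here: through [quadE] it bounds the sum above by zero. *)
  by rewrite -(pmulr_rle0 _ mu_gt0) -oppr_ge0 -quadE.
apply/colP => i; apply/eqP; rewrite -subr_eq0 -sqrf_eq0.
by apply/eqP/(psumr_eq0P _ sum0) => // j _; exact: sqr_ge0.
Qed.

Theorem proposition4p1 (R : realType) (m n : nat)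
    (A : 'M[R]_(m, n)) (b : 'cV[R]_m) (c : 'cV[R]_n) (W : 'M[R]_n)
    (W_psd : possemidefmx W)
    (strictly_feasible : exists x : 'cV[R]_n, forall i, 0 < (A *m x + b) i 0)
    (sublevel_bounded : forall gamma : R, bounded_set (qp_sublevel A b c W gamma))
    (AtAW_pd : posdefmx (A^T *m A + W))
    (x : 'cV[R]_n) (s lam : 'cV[R]_m) (s_gt0 : forall i, 0 < s i 0)
    (v : 'cV[R]_m) (mu : R) (mu_gt0 : 0 < mu)
    (s_def : s = Num.sqrt mu *: expmx (- v))
    (dx : 'cV[R]_n) (ds dlam : 'cV[R]_m)
    (newton : barrier_newton_system A b c W mu x s lam dx ds dlam) :
  s + ds = s \odot (const_mx 1 - log_newton_dir A b c W v mu).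
Proof.
case: newton => dual primal compl.
have W_ge0 := W_psd.2.
have r_neq0 : Num.sqrt mu != 0 by rewrite gt_eqF ?sqrtr_gt0.
have E_neq0 i : expR (v i 0) != 0 by rewrite gt_eqF ?expR_gt0.
(* The value forced by solving [s + ds = s \odot (const_mx 1 - d)] for [d]. *)
pose d : 'cV[R]_m := - (map_mx (fun t => t^-1) s \odot ds).
have step : s + ds = s \odot (const_mx 1 - d).
  by apply/colP => i; rewrite !mxE; field; rewrite gt_eqF.
have d_sol : log_newton_system A b c W v mu d (x + dx).
  split.
    (* [compl] eliminates [lam + dlam]; the rest is entrywise, with [s^-1 = e^v / sqrt mu]. *)
    rewrite -dual -compl scalemxAr; congr (_ *m _).
    apply/colP => i; rewrite /d s_def !mxE expRN.
    by rewrite -{3}(sqr_sqrtr (ltW mu_gt0)); field; rewrite E_neq0.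
  rewrite -primal step s_def; apply/colP => i; rewrite !mxE; ring.
(* [xget] picks some solution [d'], equal to [d] by uniqueness; its default [0] is ruled out because
   [d] is a solution. *)
rewrite step /log_newton_dir; case: xgetP => [d' _ [x' d'_sol]|no_sol].
  by rewrite (log_newton_system_unique W_ge0 mu_gt0 d_sol d'_sol).
by case: (no_sol d); exists (x + dx).
Qed.
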